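(* For every $\rho \in (0,1)$, there exist a full-rank matrix $A\in\mathbb{R}^{2\times 1}$, a vector $b\in\mathbb{R}^2$, and a $(1,1,\rho)$-OSI $\Omega\in\mathbb{R}^{2\times 2}$ such that the sketch-and-solve estimator $\widetilde x\in\operatorname{argmin}_{x\in\mathbb{R}}\|\Omega^\top(Ax-b)\|_2$ satisfies \[ \frac{\|A\widetilde x-b\|_2}{\min_{x\in\mathbb{R}} \|Ax-b\|_2} = \begin{cases} 1, & \text{with probability } 1-\rho, \\ \sqrt{2},& \text{with probability } \rho.\end{cases} \]
   Context: Definition (oblivious subspace injection, OSI). Fix integers $1\le s\le n$ and $k\ge1$, an injectivity parameter $\alpha\in(0,1]$, and a failure parameter $\rho\in[0,1)$. A random matrix $\Omega\in\mathbb{R}^{n\times k}$ is an $(s,\alpha,\rho)$-OSI if (i) (isotropy) $\mathbb{E}[\Omega\Omega^\top]=I_n$; and (ii) (injectivity) for every fixed $s$-dimensional subspace $V\subseteq\mathbb{R}^n$, $\mathbb{P}\{\|\Omega^\top x\|_2^2\ge\alpha\|x\|_2^2\text{ for all }x\in V\}\ge1-\rho$. *)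

(* Defs.v *)
From HB Require Import structures.
From mathcomp Require Import all_boot all_order all_algebra.
From mathcomp Require Import all_classical all_reals all_analysis.
Set Implicit Arguments.
Unset Strict Implicit.
Unset Printing Implicit Defensive.
Import Order.TTheory GRing.Theory Num.Theory.
Import numFieldNormedType.Exports.
Local Open Scope classical_set_scope.
Local Open Scope ring_scope.

(* The library norm on matrices is the sup norm, hence this Euclidean one. *)
Definition norm2 (R : realType) (n : nat) (v : 'cV[R]_n) : R :=
  Num.sqrt (\sum_i v i ord0 ^+ 2).

Definition random_matrix (d : measure_display) (T : measurableType d)
    (R : realType) (n k : nat) (Omega : T -> 'M[R]_(n, k)) : Prop :=
  forall i j, measurable_fun setT (fun w => Omega w i j).

(* In [osi_isotropy], a finite value of ['E_P] forces integrability of the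
   entry.  In [osi_injectivity], the event is measurable as soon as Omega is a
   random matrix: by continuity in x it is a countable intersection. *)
Record is_OSI (d : measure_display) (T : measurableType d) (R : realType)
    (P : probability T R) (n k : nat) (Omega : T -> 'M[R]_(n, k))
    (s : nat) (alpha rho : R) : Prop := IsOSI {
  osi_dim : (1 <= s <= n)%N /\ (1 <= k)%N;
  osi_alpha : 0 < alpha <= 1;
  osi_rho : 0 <= rho < 1;
  osi_random : random_matrix Omega;
  osi_isotropy : forall i j : 'I_n,
    expectation P (fun w => (Omega w *m (Omega w)^T) i j)
      = ((1%:M : 'M[R]_n) i j)%:E;
  osi_injectivity : forall V : {vspace 'cV[R]_n}, \dim V = s ->
    ((1 - rho)%:E <= P [set w | forall x : 'cV[R]_n, x \in V ->
        (alpha * norm2 x ^+ 2 <= norm2 ((Omega w)^T *m x) ^+ 2)%R])%E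
}.

Definition argmin (R : realType) (X : Type) (f : X -> R) : set X :=
  [set x | forall y, f x <= f y].

Definition is_min (R : realType) (X : Type) (f : X -> R) (m : R) : Prop :=
  exists2 x, argmin f x & f x = m.

(* The unknown is a scalar x, read as the 1 x 1 matrix x%:M. *)
Definition residual (R : realType) (n : nat) (A : 'M[R]_(n, 1))
    (b : 'cV[R]_n) (x : R) : 'cV[R]_n :=
  A *m x%:M - b.

Definition sketch_and_solve (d : measure_display) (T : measurableType d)
    (R : realType) (P : probability T R) (n k : nat) (A : 'M[R]_(n, 1))
    (b : 'cV[R]_n) (Omega : T -> 'M[R]_(n, k)) (xt : {RV P >-> R}) : Prop :=
  forall w, argmin (fun x => norm2 ((Omega w)^T *m residual A b x)) (xt w).

(* Main.v *)
(** Take A = e1, b = e2, and let the random sign s be 0 with probability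
    1 - rho and 1, -1 with probability rho / 2 each.  Sketch with
    Omega = [[1, 0], [s, 1 - s^2]]: this is the identity for s = 0, and has
    Gram matrix [[1, s], [s, 1]] for s = 1, -1.  Averaging over s kills the
    off-diagonal entries, and injectivity can only fail when s <> 0.  As
    |Omega^T (A x - b)|^2 = (x - s)^2 + (1 - s^2)^2, the sketched minimizer is
    s itself, with residual sqrt (1 + s^2) against the optimal value 1. *)

Require Import Defs.
From HB Require Import structures.
From mathcomp Require Import all_boot all_order all_algebra.
From mathcomp Require Import all_classical all_reals all_analysis.
From mathcomp Require Import measurable_realfun ring lra.
Import Order.TTheory GRing.Theory Num.Theory.
Import numFieldNormedType.Exports.
Local Open Scope classical_set_scope.
Local Open Scope ring_scope.

(** A Dirac mass is an indicator on all sets, so the formula for [P A] covers every [A] and events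
    can be evaluated atom by atom. For nonnegative functions the integral is additive over the
    mixture; a signed [f] is split into positive and negative parts. *)
Lemma probability_mixture_dirac (d : measure_display) (T : measurableType d)
    (R : realType) (n : nat) (w : nat -> {nonneg R}) (a : nat -> T) :
  \sum_(k < n) (w k)%:num = 1 ->
  exists P : probability T R,
    (forall A, P A = (\sum_(k < n) (w k)%:num * (a k \in A)%:R)%:E) /\
    (forall f : T -> R, measurable_fun setT f ->
       expectation P f = (\sum_(k < n) (w k)%:num * f (a k))%:E).
Proof.
move=> sum_w.
pose m k : measure T R := mscale (w k) (\d_(a k)).
pose mu : measure T R := msum m n.
have muE A : mu A = (\sum_(k < n) (w k)%:num * (a k \in A)%:R)%:E.
  by rewrite -sumEFin; apply: eq_bigr => k _; rewrite EFinM -diracE.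
have mu1 : mu [set: T] = 1%E.
  rewrite muE -[in RHS]sum_w; congr EFin.
  by apply: eq_bigr => k _; rewrite in_setT mulr1.
pose P : probability T R := HB.pack_for (probability T R) (Measure.sort mu)
  (Measure_isProbability.Build _ _ _ (Measure.sort mu) mu1).
exists P; split => // f mf.
have mEf : measurable_fun setT (EFin \o f : T -> \bar R) by exact/measurable_EFinP.
have int_ge0 g : measurable_fun setT g -> (forall x, 0 <= g x)%E ->
    (\int[mu]_x g x = \sum_(k < n) (w k)%:num%:E * g (a k))%E.
  move=> mg g0; rewrite ge0_integral_measure_sum//; apply: eq_bigr => k _.
  by rewrite ge0_integral_mscale// integral_dirac// diracT mul1e.
rewrite unlock; transitivity (\int[mu]_x (EFin \o f) x)%E => //.
rewrite integralE !int_ge0 ?sumEFin//; last 2 first.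
- exact: measurable_funeneg.
- exact: measurable_funepos.
(* In [\bar R], recombining the two weighted sums into one needs finite negative parts. *)
have fin_neg x : ((EFin \o f)^\- x)%E \is a fin_num by rewrite funenegE/= -EFin_max.
rewrite -fin_num_sumeN => [|k _]; last by rewrite fin_numM.
rewrite -big_split/= -sumEFin; apply: eq_bigr => k _.
rewrite -muleN -muleDr//; last by rewrite fin_num_adde_defl// fin_numN.
rewrite EFinM; congr (_ * _)%E.
by rewrite [RHS](congr1 (@^~ (a k)) (funeposneg (EFin \o f))).
Qed.

(** The polynomial [1 - s ^+ 2] stands in for the indicator of [s = 0], with which it agrees at 0, 1
    and -1; it keeps the entries measurable on the whole line. *)
Definition signed_sketch {R : realType} (s : R) : 'M[R]_2 :=
  \matrix_(i < 2, j < 2)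
    (if i == 0 then (if j == 0 then 1 else 0)
     else if j == 0 then s else 1 - s ^+ 2).

Lemma signed_sketch0 (R : realType) : signed_sketch (0 : R) = 1%:M.
Proof.
apply/matrixP => i j; rewrite !mxE expr0n subr0.
by case: i j => [[|[|//]] ?] [[|[|//]] ?].
Qed.

(** The off-diagonal entries are odd in [s], hence average to zero under a symmetric law; the last
    diagonal entry is 1 at the three atoms 0, 1, -1. *)
Lemma signed_sketch_gram (R : realType) (s : R) (i j : 'I_2) :
  (signed_sketch s *m (signed_sketch s)^T) i j =
    if i == 0 then (if j == 0 then 1 else s)
    else if j == 0 then s else s ^+ 2 + (1 - s ^+ 2) ^+ 2.
Proof.
rewrite !mxE !big_ord_recl big_ord0 !mxE /=.
by case: ifP => _; case: ifP => _; ring.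
Qed.

Lemma norm2_residual_delta (R : realType) (x : R) :
  norm2 (@residual R 2 (delta_mx 0 0) (delta_mx 1 0) x) = Num.sqrt (1 + x ^+ 2).
Proof.
rewrite /norm2 /residual !big_ord_recl big_ord0 !mxE !big_ord1 !mxE /=.
by congr Num.sqrt; ring.
Qed.

Lemma norm2_signed_sketch_residual (R : realType) (s x : R) :
  norm2 ((signed_sketch s)^T *m @residual R 2 (delta_mx 0 0) (delta_mx 1 0) x) =
  Num.sqrt ((x - s) ^+ 2 + (1 - s ^+ 2) ^+ 2).
Proof.
rewrite /norm2 /residual !big_ord_recl big_ord0 !mxE !big_ord_recl !big_ord0.
rewrite !mxE !big_ord1 !mxE /=.
by congr Num.sqrt; ring.
Qed.

(** Only the square [(x - s) ^+ 2] depends on [x]. Uniqueness of the minimizer is what later pins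
    down every admissible estimator. *)
Lemma argmin_signed_sketch (R : realType) (s x : R) :
  argmin (fun x => norm2 ((signed_sketch s)^T *m
    @residual R 2 (delta_mx 0 0) (delta_mx 1 0) x)) x <-> x = s.
Proof.
have sqr2_ge0 (y : R) : 0 <= (y - s) ^+ 2 + (1 - s ^+ 2) ^+ 2.
  by rewrite addr_ge0// sqr_ge0.
split=> [/(_ s)|-> y]; rewrite !norm2_signed_sketch_residual ler_sqrt//.
  rewrite subrr expr0n lerD2r => xs.
  by apply/eqP; rewrite -subr_eq0 -sqrf_eq0 eq_le xs sqr_ge0.
by rewrite lerD2r subrr expr0n sqr_ge0.
Qed.

Theorem theorem3p1 (R : realType) (rho : R) (hrho : 0 < rho < 1) :
  exists (A : 'M[R]_(2, 1)) (b : 'cV[R]_2) (m : R)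
         (d : measure_display) (T : measurableType d) (P : probability T R)
         (Omega : T -> 'M[R]_(2, 2)),
    [/\ \rank A = 1%N,
        is_min (fun x : R => norm2 (residual A b x)) m /\ 0 < m,
        is_OSI P Omega 1 1 rho,
        exists xt : {RV P >-> R}, sketch_and_solve A b Omega xt
      & forall xt : {RV P >-> R}, sketch_and_solve A b Omega xt ->
          P [set w | norm2 (residual A b (xt w)) / m = 1] = (1 - rho)%:E /\
          P [set w | norm2 (residual A b (xt w)) / m = Num.sqrt 2] = rho%:E].
Proof.
have /andP[rho_gt0 rho_lt1] := hrho.
have rho_ge0 := ltW rho_gt0.
have onem_rho_ge0 : 0 <= 1 - rho by rewrite subr_ge0 ltW.
have half_ge0 : 0 <= rho / 2 by rewrite divr_ge0.
(* Index 0 gets [1 - rho]; indices 1 and 2 fall through to the default [rho / 2]. *)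
pose weight := nth (NngNum half_ge0) [:: NngNum onem_rho_ge0].
have weight1 : \sum_(k < 3) (weight k)%:num = 1.
  by rewrite !big_ord_recl big_ord0/=; field.
have [P [PE EP]] := @probability_mixture_dirac _ (measurableTypeR R) R 3 weight
  (nth 0 [:: 0; 1; -1]) weight1.
have {}PE B : P B = ((1 - rho) * (0 \in B)%:R + rho / 2 * (1 \in B)%:R +
    rho / 2 * (-1 \in B)%:R)%:E.
  by rewrite PE !big_ord_recl big_ord0/= addr0 addrA.
have {}EP f : measurable_fun setT f -> expectation P f =
    ((1 - rho) * f 0 + rho / 2 * f 1 + rho / 2 * f (-1))%:E.
  by move=> mf; rewrite EP// !big_ord_recl big_ord0/= addr0 addrA.
(* The sample space is the real line, and an outcome is the sign itself. *)
exists (delta_mx 0 0), (delta_mx 1 0), 1, _, (measurableTypeR R), P.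
exists (@signed_sketch R); split.
- by rewrite mxrank_delta.
- split=> //; exists 0; last by rewrite norm2_residual_delta expr0n addr0 sqrtr1.
  move=> y; rewrite !norm2_residual_delta ler_sqrt ?addr_ge0 ?sqr_ge0//.
  by rewrite lerD2l expr0n sqr_ge0.
- split=> //; first by rewrite ltr01 lexx.
  + by rewrite rho_ge0.
  + move=> [[|[|//]] ?] [[|[|//]] ?]; under eq_fun do rewrite mxE/=.
    - exact: measurable_cst.
    - exact: measurable_cst.
    - exact: measurable_id.
    - by apply: measurable_funB => //; exact: measurable_funX.
  + move=> [[|[|//]] ?] [[|[|//]] ?]; under eq_fun do rewrite signed_sketch_gram/=.
    - by rewrite EP ?mxE//=; congr EFin; field.
    - by rewrite EP ?mxE//=; congr EFin; field.
    - by rewrite EP ?mxE//=; congr EFin; field.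
    - rewrite EP ?mxE/=; first by congr EFin; field.
      apply: measurable_funD; first exact: measurable_funX.
      by apply/measurable_funX/measurable_funB => //; exact: measurable_funX.
  (* The atom 0 lies in the event for every [V], since the sketch is the identity there, and already
     carries mass [1 - rho]; the other two terms are nonnegative. *)
  + move=> V _; rewrite PE lee_fin mem_set/= ?mulr1.
      by rewrite -addrA lerDl addr_ge0// mulr_ge0.
    by move=> x _; rewrite signed_sketch0 trmx1 !mul1mx mul1r.
- have mid : isMeasurableFun _ _ (measurableTypeR R) R idfun.
    by constructor; exact: measurable_id.
  exists (HB.pack_for {RV P >-> R} (idfun : measurableTypeR R -> R) mid).
  by move=> w; apply/argmin_signed_sketch.
- move=> xt xt_min.
  (* By uniqueness [xt w = w] at every [w], so the ratio depends on the outcome alone. *)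
  have xtE w : norm2 (@residual R 2 (delta_mx 0 0) (delta_mx 1 0) (xt w)) / 1 =
      Num.sqrt (1 + w ^+ 2).
    rewrite divr1 norm2_residual_delta.
    by rewrite ((argmin_signed_sketch _ _ _).1 (xt_min w)).
  have sqr_ge0D1 (y : R) : 0 <= 1 + y ^+ 2 by rewrite addr_ge0 ?sqr_ge0.
  rewrite !PE; split; congr EFin.
  (* The ratio is 1 at the atom 0 and [Num.sqrt 2] at both 1 and -1, whose masses add up to
     [rho]. *)
  + rewrite mem_set /=; last by rewrite xtE expr0n addr0 sqrtr1.
    rewrite !memNset /=; [by rewrite !mulr0 !addr0 mulr1| |];
      rewrite xtE -[in RHS]sqrtr1 => /eqP; rewrite eqr_sqrt// => /eqP; lra.
  + rewrite memNset /=; last first.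
      by rewrite xtE => /eqP; rewrite eqr_sqrt// => /eqP; lra.
    by rewrite !mem_set /= ?xtE ?sqrrN ?expr1n//; field.
Qed.
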